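(* Let $\mathbf{L}$ be a nonzero normed space endowed with a metric $\diamond$-operation, and let $E$, $F$ be $\mathbf{L}$-spaces. For $U\in\mathbf{L}\otimes(E\otimes F)$ put $$\|U\|_{\mathbf{L}}:=\inf\Big\{\sum_{k=1}^n\|a_k\|\,\|u_k\|\,\|v_k\|\Big\},$$ the infimum being over all representations $U=\sum_{k=1}^n a_k\cdot(u_k\diamond v_k)$ with $n\in\mathbb{N}$, $a_k\in\mathcal{B}(\mathbf{L})$, $u_k\in\mathbf{L}E$, $v_k\in\mathbf{L}F$. Let $E\otimes_{\mathbf{L}}F$ denote the linear space $E\otimes F$ endowed with $\|\cdot\|_{\mathbf{L}}$, and let $\vartheta:E\times F\to E\otimes_{\mathbf{L}}F$, $(x,y)\mapsto x\otimes y$. Then the pair $(E\otimes_{\mathbf{L}}F,\vartheta)$ is a non-completed general $\mathbf{L}$-tensor product of $E$ and $F$.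
   Context: Spaces are over $\mathbb{C}$; $\otimes$ is the algebraic tensor product; $\mathcal{B}(\mathbf{L})$ is the algebra of bounded operators on $\mathbf{L}$ with the operator norm. For a linear space $E$, $\mathbf{L}E:=\mathbf{L}\otimes E$, with elementary tensors written $\xi x$; it is a left $\mathcal{B}(\mathbf{L})$-module via $a\cdot(\xi x)=a(\xi)x$. An $\mathbf{L}$-seminorm on $E$ is a seminorm on $\mathbf{L}E$ with $\|a\cdot u\|\le\|a\|\|u\|$ for all $a\in\mathcal{B}(\mathbf{L})$, $u\in\mathbf{L}E$. A seminormed $\mathbf{L}$-space is a linear space $E$ with an $\mathbf{L}$-seminorm; it is called an $\mathbf{L}$-space (normed $\mathbf{L}$-space) if this seminorm is a norm. A metric $\diamond$-operation is a bilinear operator $\diamond:\mathbf{L}\times\mathbf{L}\to\mathbf{L}$ with $\|\xi\diamond\eta\|=\|\xi\|\|\eta\|$ for all $\xi,\eta$. For $u\in\mathbf{L}E$, $v\in\mathbf{L}F$ the element $u\diamond v\in\mathbf{L}(E\otimes F)$ is defined by bilinear extension of $\xi x\diamond\eta y:=(\xi\diamond\eta)(x\otimes y)$. (Every $U\in\mathbf{L}(E\otimes F)$ has a representation of the form used in the definition of $\|U\|_{\mathbf{L}}$.) For a linear operator $\varphi:E\to F$, its amplification is $\varphi_\infty:\mathbf{L}E\to\mathbf{L}F$, $\xi x\mapsto\xi\varphi(x)$; between seminormed $\mathbf{L}$-spaces, $\varphi$ is $\mathbf{L}$-bounded if $\varphi_\infty$ is bounded, and $\|\varphi\|_{\mathbf{L}b}:=\|\varphi_\infty\|$.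 For a bilinear operator $\mathcal{R}:E\times F\to G$, its amplification $\mathcal{R}_\infty:\mathbf{L}E\times\mathbf{L}F\to\mathbf{L}G$ is the bilinear operator with $\mathcal{R}_\infty(\xi x,\eta y)=(\xi\diamond\eta)\mathcal{R}(x,y)$; $\mathcal{R}$ is $\mathbf{L}$-bounded (respectively, $\mathbf{L}$-contractive) if $\mathcal{R}_\infty$ is bounded (respectively, contractive), and $\|\mathcal{R}\|_{\mathbf{L}b}:=\|\mathcal{R}_\infty\|$. A non-completed general $\mathbf{L}$-tensor product of $E$ and $F$ is a pair $(\Theta,\theta)$ where $\Theta$ is a (normed) $\mathbf{L}$-space and $\theta:E\times F\to\Theta$ is an $\mathbf{L}$-contractive bilinear operator such that, for every (normed) $\mathbf{L}$-space $G$ and every $\mathbf{L}$-bounded bilinear operator $\mathcal{R}:E\times F\to G$, there is a unique $\mathbf{L}$-bounded linear operator $R:\Theta\to G$ with $R\theta=\mathcal{R}$, and moreover $\|R\|_{\mathbf{L}b}=\|\mathcal{R}\|_{\mathbf{L}b}$. *)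

(* Defs.v *)
From HB Require Import structures.
From mathcomp Require Import all_boot all_order all_algebra.
From mathcomp Require Import complex.
From mathcomp Require Import all_classical all_reals all_analysis.

Set Implicit Arguments.
Unset Strict Implicit.
Unset Printing Implicit Defensive.

Import Order.TTheory GRing.Theory Num.Theory.
Import numFieldNormedType.Exports.

Local Open Scope classical_set_scope.
Local Open Scope quotient_scope.
Local Open Scope ring_scope.
Local Open Scope complex_scope.

(** Algebraic tensor product of two modules over a commutative ring: the formal
    finite sums of pairs, modulo the congruence generated by bilinearity.  A
    formal sum is a sequence of pairs (scalars are absorbed in the first
    component) and addition is concatenation. *)

Inductive tensor_rel (K : comNzRingType) (E F : lmodType K) :
  seq (E * F) -> seq (E * F) -> Prop :=
| Tensor_refl s : tensor_rel s s
| Tensor_sym s t : tensor_rel s t -> tensor_rel t s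
| Tensor_trans s t r : tensor_rel s t -> tensor_rel t r -> tensor_rel s r
| Tensor_cat s s' t t' :
    tensor_rel s s' -> tensor_rel t t' -> tensor_rel (s ++ t) (s' ++ t')
| Tensor_catC s t : tensor_rel (s ++ t) (t ++ s)
| Tensor_0l y : tensor_rel [:: (0, y)] [::]
| Tensor_Dl x x' y : tensor_rel [:: (x + x', y)] [:: (x, y); (x', y)]
| Tensor_Dr x y y' : tensor_rel [:: (x, y + y')] [:: (x, y); (x, y')]
| Tensor_Z c x y : tensor_rel [:: (c *: x, y)] [:: (x, c *: y)].

Section TensorProduct.
Variables (K : comNzRingType) (E F : lmodType K).
Implicit Types (s t : seq (E * F)) (c : K).

Definition tensor_eqv s t : bool := `[< tensor_rel s t >].

Let tensor_eqvP : equiv_class_of tensor_eqv.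
Proof.
split.
- by move=> s; apply/asboolP; exact: Tensor_refl.
- by move=> s t; apply/asboolP/asboolP; exact: Tensor_sym.
- move=> t s r /asboolP st /asboolP tr; apply/asboolP.
  exact: Tensor_trans st tr.
Qed.

Canonical tensor_equiv := EquivRelPack tensor_eqvP.

Definition tensor := {eq_quot tensor_eqv}.

HB.instance Definition _ := Choice.on tensor.
HB.instance Definition _ := EqQuotient.on tensor.

Definition tensor_zscale c s := [seq (c *: p.1, p.2) | p <- s].

Definition tensor_zero : tensor := \pi_tensor [::].
Definition tensor_add (u v : tensor) : tensor := \pi_tensor (repr u ++ repr v).
Definition tensor_scale c (u : tensor) : tensor :=
  \pi_tensor (tensor_zscale c (repr u)).
Definition tensor_opp (u : tensor) : tensor := tensor_scale (- 1) u.

Definition tens (x : E) (y : F) : tensor := \pi_tensor [:: (x, y)].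

Let eqtP s t : reflect (tensor_rel s t) (s == t %[mod tensor]).
Proof. by rewrite piE; apply: asboolP. Qed.

Let pi_eq s t : tensor_rel s t -> \pi_tensor s = \pi_tensor t.
Proof. by move=> st; apply/eqP/eqtP. Qed.

Let repr_rel s : tensor_rel (repr (\pi_tensor s)) s.
Proof. by apply/eqtP; rewrite reprK. Qed.

Let tensorW (P : tensor -> Prop) :
  (forall s, P (\pi_tensor s)) -> forall u, P u.
Proof. by move=> Ppi u; rewrite -[u]reprK; apply: Ppi. Qed.

Let addE s t :
  tensor_add (\pi_tensor s) (\pi_tensor t) = \pi_tensor (s ++ t).
Proof. by apply: pi_eq; apply: Tensor_cat; apply: repr_rel. Qed.

Let zscale_rel c s t :
  tensor_rel s t -> tensor_rel (tensor_zscale c s) (tensor_zscale c t).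
Proof.
elim=> {s t} [s|s t _|s t r _ IH1 _ IH2|s s' t t' _ IH1 _ IH2|s t|y|x x' y|x y y'|d x y].
- exact: Tensor_refl.
- exact: Tensor_sym.
- exact: Tensor_trans IH1 IH2.
- by rewrite /tensor_zscale !map_cat; apply: Tensor_cat.
- by rewrite /tensor_zscale !map_cat; apply: Tensor_catC.
- by rewrite /= scaler0; apply: Tensor_0l.
- by rewrite /= scalerDr; apply: Tensor_Dl.
- exact: Tensor_Dr.
- by rewrite /= scalerA mulrC -scalerA; apply: Tensor_Z.
Qed.

Let scaleE c s :
  tensor_scale c (\pi_tensor s) = \pi_tensor (tensor_zscale c s).
Proof. by apply: pi_eq; apply: zscale_rel; apply: repr_rel. Qed.

Let addA : associative tensor_add.
Proof.
elim/tensorW=> s; elim/tensorW=> t; elim/tensorW=> r.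
by rewrite (addE t r) (addE s t) !addE catA.
Qed.

Let addC : commutative tensor_add.
Proof.
by elim/tensorW=> s; elim/tensorW=> t; rewrite !addE; apply: pi_eq; apply: Tensor_catC.
Qed.

Let add0 : left_id tensor_zero tensor_add.
Proof. by elim/tensorW=> s; rewrite addE. Qed.

Let zscaleDl a b s :
  tensor_rel (tensor_zscale (a + b) s) (tensor_zscale a s ++ tensor_zscale b s).
Proof.
elim: s => [|[x y] s IH] /=; first exact: Tensor_refl.
rewrite scalerDl.
apply: (Tensor_trans (Tensor_cat (Tensor_Dl (a *: x) (b *: x) y) IH)).
rewrite /= -(cat1s _ (tensor_zscale a s ++ _)) -(cat1s _ (tensor_zscale a s ++ _ :: _)).
apply: (@Tensor_cat _ _ _ [:: _] [:: _]); first exact: Tensor_refl.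
rewrite -cat1s -(cat1s _ (tensor_zscale b s)) !catA.
apply: Tensor_cat; [exact: Tensor_catC | exact: Tensor_refl].
Qed.

Let zscale0 s : tensor_rel (tensor_zscale 0 s) [::].
Proof.
elim: s => [|[x y] s IH] /=; first exact: Tensor_refl.
by rewrite scale0r; exact: (Tensor_cat (@Tensor_0l K E F y) IH).
Qed.

Let zscale1 s : tensor_zscale 1 s = s.
Proof. by elim: s => [|[x y] s IH] //=; rewrite scale1r IH. Qed.

Let addN : left_inverse tensor_zero tensor_opp tensor_add.
Proof.
elim/tensorW=> s; rewrite /tensor_opp scaleE addE; apply: pi_eq.
rewrite -{2}(zscale1 s); apply: Tensor_trans (Tensor_sym (zscaleDl _ _ _)) _.
by rewrite addNr.
Qed.

HB.instance Definition _ := GRing.isZmodule.Build tensor addA addC add0 addN.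

Let scaleA a b u :
  tensor_scale a (tensor_scale b u) = tensor_scale (a * b) u.
Proof.
elim/tensorW: u => s; rewrite !scaleE /tensor_zscale -map_comp; congr (\pi _).
by apply: eq_map => -[x y] /=; rewrite scalerA.
Qed.

Let scale1 : left_id 1 tensor_scale.
Proof. by elim/tensorW=> s; rewrite scaleE zscale1. Qed.

Let scaleDr : right_distributive tensor_scale +%R.
Proof.
move=> a; elim/tensorW=> s; elim/tensorW=> t.
by rewrite [_ + _]addE !scaleE [RHS]addE /tensor_zscale map_cat.
Qed.

Let scaleDl u : {morph tensor_scale^~ u : a b / a + b}.
Proof.
move=> a b; elim/tensorW: u => s.
by rewrite !scaleE [RHS]addE; apply: pi_eq; apply: zscaleDl.
Qed.

HB.instance Definition _ := GRing.Zmodule_isLmodule.Build K tensor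
  scaleA scale1 scaleDr scaleDl.

Let linE c s t : c *: (\pi_tensor s : tensor) + (\pi_tensor t : tensor) =
  \pi_tensor (tensor_zscale c s ++ t).
Proof. by rewrite -addE -scaleE. Qed.

Lemma tens_is_bilinear : bilinear_for *:%R *:%R tens.
Proof.
split=> [y|x] a u v; rewrite /= /tens.
- rewrite linE; apply: pi_eq.
  exact: Tensor_Dl.
- rewrite linE; apply: pi_eq.
  apply: (Tensor_trans (Tensor_Dr _ _ _)).
  apply: (@Tensor_cat _ _ _ [:: _] [:: _] [:: _] [:: _]).
    exact/Tensor_sym/Tensor_Z.
  exact: Tensor_refl.
Qed.

HB.instance Definition _ :=
  @bilinear_isBilinear.Build K E F tensor *:%R *:%R tens tens_is_bilinear.

(** The linear map determined by [x ⊗ y |-> f x y]; it is meaningful only for a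
    bilinear [f], see [tlift_tens], [tlift_is_linear] and [tlift_unique]. *)
Definition tlift (G : lmodType K) (f : E -> F -> G) (u : tensor) : G :=
  \sum_(p <- repr u) f p.1 p.2.

Section Lift.
Variables (G : lmodType K) (f : {bilinear E -> F -> G}).

Let sum_rel s t : tensor_rel s t ->
  \sum_(p <- s) f p.1 p.2 = \sum_(p <- t) f p.1 p.2.
Proof.
elim=> {s t} [s|s t _ //|s t r _ -> _ //|s s' t t' _ H1 _ H2|s t|y|x x' y|x y y'|d x y];
  rewrite ?big_cat ?big_cons ?big_nil //= ?addr0.
- by rewrite H1 H2.
- by rewrite addrC.
- by rewrite linear0l.
- by rewrite linearDl.
- by rewrite linearDr.
- by rewrite linearZl_LR linearZr_LR.
Qed.

Let tlift_pi s : tlift f (\pi_tensor s) = \sum_(p <- s) f p.1 p.2.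
Proof. exact/sum_rel/repr_rel. Qed.

Lemma tlift_tens x y : tlift f (tens x y) = f x y.
Proof. by rewrite tlift_pi big_seq1. Qed.

Lemma tlift_is_linear : linear (tlift f).
Proof.
move=> a; elim/tensorW=> s; elim/tensorW=> t.
rewrite linE !tlift_pi big_cat /= big_map.
by rewrite scaler_sumr; congr (_ + _); apply: eq_bigr => p _; rewrite linearZl_LR.
Qed.

End Lift.

Lemma tensor_sum (u : tensor) : u = \sum_(p <- repr u) tens p.1 p.2.
Proof.
rewrite -[LHS]reprK; elim: (repr u) => [|[x y] s IH]; first by rewrite big_nil.
by rewrite big_cons /= -IH [RHS]addE.
Qed.

Lemma tlift_unique (G : lmodType K) (f : E -> F -> G)
    (T : {linear tensor -> G}) :
  (forall x y, T (tens x y) = f x y) -> T =1 tlift f.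
Proof.
move=> Tf u; rewrite [in LHS](tensor_sum u) linear_sum.
by apply: eq_bigr => p _; rewrite Tf.
Qed.

End TensorProduct.

Arguments tens {K E F}.
Arguments tlift {K E F G}.

Section SeminormedSpaces.
Variable R : realType.

(** The library norm over [R[i]] takes its values in [R[i]]. *)
Definition rnorm (V : normedZmodType R[i]) (x : V) : R := complex.Re `|x|.

Definition is_seminorm (V : lmodType R[i]) (p : V -> R) : Prop :=
  [/\ forall u, 0 <= p u,
      forall u v, p (u + v) <= p u + p v &
      forall (c : R[i]) u, p (c *: u) = rnorm c * p u].

Definition op_bounded (V W : Type) (p : V -> R) (q : W -> R) (T : V -> W) :=
  exists M : R, forall u, q (T u) <= M * p u.

Definition op_norm (V W : Type) (p : V -> R) (q : W -> R) (T : V -> W) : R :=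
  sup [set q (T u) | u in [set u | p u <= 1]].

Definition biop_bounded (V W X : Type) (p : V -> R) (q : W -> R) (r : X -> R)
    (B : V -> W -> X) :=
  exists M : R, forall u v, r (B u v) <= M * p u * q v.

Definition biop_contractive (V W X : Type) (p : V -> R) (q : W -> R)
    (r : X -> R) (B : V -> W -> X) :=
  forall u v, r (B u v) <= p u * q v.

Definition biop_norm (V W X : Type) (p : V -> R) (q : W -> R) (r : X -> R)
    (B : V -> W -> X) : R :=
  sup [set r (B uv.1 uv.2) | uv in [set uv | p uv.1 <= 1 /\ q uv.2 <= 1]].

End SeminormedSpaces.

Section LSpaces.
Variables (R : realType) (L : normedModType R[i]).

Notation "''L' E" := (tensor L E) (at level 8, E at level 2).

Definition bounded_op (a : {linear L -> L}) : Prop :=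
  op_bounded (@rnorm R L) (@rnorm R L) a.

Definition bop_norm (a : {linear L -> L}) : R :=
  op_norm (@rnorm R L) (@rnorm R L) a.

Definition Lact (E : lmodType R[i]) (a : {linear L -> L}) : 'L E -> 'L E :=
  tlift (fun xi x => tens (a xi) x).

Definition is_Lseminorm (E : lmodType R[i]) (p : 'L E -> R) : Prop :=
  is_seminorm p /\
  forall a : {linear L -> L}, bounded_op a ->
    forall u, p (Lact a u) <= bop_norm a * p u.

Definition is_Lnorm (E : lmodType R[i]) (p : 'L E -> R) : Prop :=
  is_Lseminorm p /\ forall u, p u = 0 -> u = 0.

Definition metric_diamond (dia : {bilinear L -> L -> L}) : Prop :=
  forall xi eta : L, `|dia xi eta| = `|xi| * `|eta|.

Definition amplification (E F : lmodType R[i]) (phi : E -> F) : 'L E -> 'L F :=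
  tlift (fun xi x => tens xi (phi x)).

Definition biamplification (dia : {bilinear L -> L -> L})
    (E F G : lmodType R[i]) (B : E -> F -> G) (u : 'L E) (v : 'L F) : 'L G :=
  tlift (fun xi x => tlift (fun eta y => tens (dia xi eta) (B x y)) v) u.

Definition Ldiamond (dia : {bilinear L -> L -> L}) (E F : lmodType R[i])
    (u : 'L E) (v : 'L F) : 'L (tensor E F) :=
  tlift (fun xi x => tlift (fun eta y => tens (dia xi eta) (tens x y)) v) u.

Definition Lbounded (E F : lmodType R[i]) (p : 'L E -> R) (q : 'L F -> R)
    (phi : E -> F) : Prop :=
  op_bounded p q (amplification phi).

Definition Lb_norm (E F : lmodType R[i]) (p : 'L E -> R) (q : 'L F -> R)
    (phi : E -> F) : R :=
  op_norm p q (amplification phi).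

Definition Lbounded2 (dia : {bilinear L -> L -> L}) (E F G : lmodType R[i])
    (p : 'L E -> R) (q : 'L F -> R) (r : 'L G -> R) (B : E -> F -> G) : Prop :=
  biop_bounded p q r (biamplification dia B).

Definition Lcontractive2 (dia : {bilinear L -> L -> L})
    (E F G : lmodType R[i]) (p : 'L E -> R) (q : 'L F -> R) (r : 'L G -> R)
    (B : E -> F -> G) : Prop :=
  biop_contractive p q r (biamplification dia B).

Definition Lb_norm2 (dia : {bilinear L -> L -> L}) (E F G : lmodType R[i])
    (p : 'L E -> R) (q : 'L F -> R) (r : 'L G -> R) (B : E -> F -> G) : R :=
  biop_norm p q r (biamplification dia B).

Definition is_Ltensor_product (dia : {bilinear L -> L -> L})
    (E F : lmodType R[i]) (nE : 'L E -> R) (nF : 'L F -> R)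
    (Th : lmodType R[i]) (nTh : 'L Th -> R)
    (theta : {bilinear E -> F -> Th}) : Prop :=
  [/\ is_Lnorm nTh,
      Lcontractive2 dia nE nF nTh theta &
      forall (G : lmodType R[i]) (nG : 'L G -> R), is_Lnorm nG ->
      forall B : {bilinear E -> F -> G}, Lbounded2 dia nE nF nG B ->
      exists T : {linear Th -> G},
        [/\ Lbounded nTh nG T,
            forall x y, T (theta x y) = B x y,
            forall T' : {linear Th -> G}, Lbounded nTh nG T' ->
              (forall x y, T' (theta x y) = B x y) -> T' =1 T &
            Lb_norm nTh nG T = Lb_norm2 dia nE nF nG B]].

Definition Ltensor_norm (dia : {bilinear L -> L -> L}) (E F : lmodType R[i])
    (nE : 'L E -> R) (nF : 'L F -> R) (U : 'L (tensor E F)) : R :=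
  inf [set s | exists (n : nat) (a : 'I_n -> {linear L -> L})
                      (u : 'I_n -> 'L E) (v : 'I_n -> 'L F),
    [/\ forall k, bounded_op (a k),
        U = \sum_(k < n) Lact (a k) (Ldiamond dia (u k) (v k)) &
        s = \sum_(k < n) bop_norm (a k) * nE (u k) * nF (v k)]].

(** [tlift] above is applied to bilinear functions, hence the amplifications have
    the expected values on elementary tensors and are linear in each argument. *)

Lemma tens_compl_bilinear (V W E F : lmodType R[i]) (a : {linear V -> W})
    (phi : {linear E -> F}) :
  bilinear_for *:%R *:%R (fun xi x => tens (a xi) (phi x)).
Proof.
by split=> w c u v /=; rewrite linearP ?linearPl ?linearPr.
Qed.

Lemma amplification_linear (E F : lmodType R[i]) (phi : {linear E -> F}) :
  linear (amplification phi).
Proof.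
pose b := bilinear_isBilinear.Build _ _ _ _ _ _ _
  (@tens_compl_bilinear L L E F idfun phi).
pose B : {bilinear L -> E -> 'L F} := HB.pack (fun xi x => tens xi (phi x)) b.
exact: (tlift_is_linear B).
Qed.

Lemma amplification_tens (E F : lmodType R[i]) (phi : {linear E -> F}) xi x :
  amplification phi (tens xi x) = tens xi (phi x).
Proof.
pose b := bilinear_isBilinear.Build _ _ _ _ _ _ _
  (@tens_compl_bilinear L L E F idfun phi).
pose B : {bilinear L -> E -> 'L F} := HB.pack (fun xi x => tens xi (phi x)) b.
exact: (tlift_tens B).
Qed.

Lemma Lact_linear (E : lmodType R[i]) (a : {linear L -> L}) :
  linear (@Lact E a).
Proof.
pose b := bilinear_isBilinear.Build _ _ _ _ _ _ _
  (@tens_compl_bilinear L L E E a idfun).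
pose B : {bilinear L -> E -> 'L E} := HB.pack (fun xi x => tens (a xi) x) b.
exact: (tlift_is_linear B).
Qed.

Lemma Lact_tens (E : lmodType R[i]) (a : {linear L -> L}) xi (x : E) :
  Lact a (tens xi x) = tens (a xi) x.
Proof.
pose b := bilinear_isBilinear.Build _ _ _ _ _ _ _
  (@tens_compl_bilinear L L E E a idfun).
pose B : {bilinear L -> E -> 'L E} := HB.pack (fun xi x => tens (a xi) x) b.
exact: (tlift_tens B).
Qed.

Section Biamplification.
Variables (dia : {bilinear L -> L -> L}) (E F G : lmodType R[i]).
Variable B : {bilinear E -> F -> G}.

Let inner_bilinear xi x :
  bilinear_for *:%R *:%R (fun eta y => tens (dia xi eta) (B x y)).
Proof.
split=> w c u v /=; first by rewrite linearPr linearPl.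
by rewrite [B x _]linearPr linearPr.
Qed.

Let inner xi x : {bilinear L -> F -> 'L G} :=
  HB.pack (fun eta y => tens (dia xi eta) (B x y))
    (bilinear_isBilinear.Build _ _ _ _ _ _ _ (inner_bilinear xi x)).

Let outer_bilinear (v : 'L F) : bilinear_for *:%R *:%R
  (fun xi x => tlift (fun eta y => tens (dia xi eta) (B x y)) v).
Proof.
split=> w c u u' /=; rewrite /tlift scaler_sumr -big_split /=;
  apply: eq_bigr => p _; first by rewrite [dia _ _]linearPl linearPl.
by rewrite [B _ _]linearPl linearPr.
Qed.

Let outer v : {bilinear L -> E -> 'L G} :=
  HB.pack (fun xi x => tlift (fun eta y => tens (dia xi eta) (B x y)) v)
    (bilinear_isBilinear.Build _ _ _ _ _ _ _ (outer_bilinear v)).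

Lemma biamplification_bilinear :
  bilinear_for *:%R *:%R (biamplification dia B).
Proof.
split=> [v|u] c w w' /=; first exact: (tlift_is_linear (outer v)).
rewrite /biamplification {1 2 3}/tlift scaler_sumr -big_split /=.
by apply: eq_bigr => p _; apply: (tlift_is_linear (inner p.1 p.2)).
Qed.

Lemma biamplification_tens xi x eta y :
  biamplification dia B (tens xi x) (tens eta y) = tens (dia xi eta) (B x y).
Proof.
rewrite /biamplification (tlift_tens (outer _)) /=.
exact: (tlift_tens (inner _ _)).
Qed.

End Biamplification.

Lemma Ldiamond_bilinear (dia : {bilinear L -> L -> L}) (E F : lmodType R[i]) :
  bilinear_for *:%R *:%R (@Ldiamond dia E F).
Proof. exact: biamplification_bilinear. Qed.

Lemma Ldiamond_tens (dia : {bilinear L -> L -> L}) (E F : lmodType R[i])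
    xi (x : E) eta (y : F) :
  Ldiamond dia (tens xi x) (tens eta y) = tens (dia xi eta) (tens x y).
Proof. exact: (biamplification_tens dia (@tens _ E F)). Qed.

End LSpaces.

(* Main.v *)
Require Import Defs.
From HB Require Import structures.
From mathcomp Require Import all_boot all_order all_algebra.
From mathcomp Require Import complex.
From mathcomp Require Import all_classical all_reals all_analysis.
From mathcomp Require Import ring lra.

Set Implicit Arguments.
Unset Strict Implicit.
Unset Printing Implicit Defensive.

Import Order.TTheory GRing.Theory Num.Theory.
Import numFieldNormedType.Exports.

Local Open Scope ring_scope.
Local Open Scope complex_scope.

(** The seminorm of the statement is the largest seminorm [N] on [L (E ⊗ F)] with
    [N (a . (u ⋄ v)) <= |a| |u| |v|] ([Ltensor_norm_largest]), and nearly
    everything is a case of this maximality.  Homogeneity and the bound for the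
    action of an operator [b] follow by applying it to [U |-> N (c U)] and
    [U |-> N (b . U)].  For an L-bounded bilinear [B], the linear map [T] with
    [T (x ⊗ y) = B (x, y)] satisfies
    [T_oo (a . (u ⋄ v)) = a . B_oo (u, v)], so that maximality yields
    [|T_oo U| <= |B| N U], while [N (u ⋄ v) <= |u| |v|] yields [|B| <= |T|].
    Uniqueness of [T] is that of a linear map given on elementary tensors.

    Two facts are not formal, and both need bounded functionals.  First, every
    [U] is a sum of elements [a . (u ⋄ v)], for otherwise the infimum is taken
    over the empty set.  Fix [xi0 <> 0]; then [xi0 ⋄ xi0 <> 0] because the
    operation is metric, and an operator of rank one carries it to any prescribed
    vector ([bounded_op_transitive]).

    Second, [N U = 0] implies [U = 0].  Normed by [x |-> |xi0 x|], the spaces [E]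
    and [F] have separating families of contractive functionals [f] and [h], and
    the axiom [|a . u| <= |a| |u|], for [a] of rank one, makes their
    amplifications bounded ([contract_right_bound]).  By maximality [N] dominates a multiple of
    [U |-> |(id ⊗ (f ⊗ h)) U|], so all these contractions of [U] vanish; and
    contractions along a separating family detect zero in an algebraic tensor
    product ([tensor_separated], applied to [E ⊗ F] and then to
    [L ⊗ (E ⊗ F)]).

    The functionals come from the Hahn-Banach theorem for a complex seminorm,
    which is derived from the real one; the latter is obtained from minimal
    sublinear functionals, which avoids extending partially defined maps. *)

(** * Hahn-Banach theorem *)

Section RealHahnBanach.
Variables (R : realType) (V : lmodType R).
Implicit Types (p q : V -> R) (x y : V).

Definition sublinear q : Prop :=
  (forall x y, q (x + y) <= q x + q y) /\
  (forall t x, 0 < t -> q (t *: x) <= t * q x).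

Lemma sublinearZ q t x : sublinear q -> 0 < t -> q (t *: x) = t * q x.
Proof.
move=> [_ qZ] t0; apply/eqP; rewrite eq_le qZ //=.
have := qZ t^-1 (t *: x); rewrite invr_gt0 => /(_ t0).
by rewrite scalerA mulVf ?gt_eqF // scale1r ler_pdivlMl.
Qed.

Lemma sublinear0 q : sublinear q -> q 0 = 0.
Proof.
move=> qs; have := @sublinearZ q 2 0 qs (ltr0n _ 2).
by rewrite scaler0 => h; lra.
Qed.

Lemma sublinearN_ge q x : sublinear q -> - q (- x) <= q x.
Proof.
move=> qs; have := qs.1 x (- x); rewrite subrr sublinear0 //.
by rewrite -lerBlDr sub0r.
Qed.

(** The pointwise infimum is finite because a sublinear [q <= p] is at least
    [- p (- x)], and it is subadditive because, of two members of the chain, the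
    smaller one can be used at both arguments. *)
Lemma sublinear_inf_chain p (A : set (V -> R)) : A !=set0%classic ->
  (forall q, A q -> sublinear q /\ forall x, q x <= p x) ->
  (forall q r, A q -> A r -> (forall x, q x <= r x) \/ (forall x, r x <= q x)) ->
  exists2 m, sublinear m & forall q x, A q -> m x <= q x.
Proof.
move=> [q0 Aq0] Asub Atot.
pose m x := inf [set q x | q in A]%classic.
have mle q x : A q -> m x <= q x.
  move=> Aq; apply: ge_inf; last by exists q.
  exists (- p (- x)) => _ [r Ar <-].
  have [rs rp] := Asub _ Ar.
  by apply: le_trans (sublinearN_ge x rs); rewrite lerN2 rp.
have lem x b : (forall q, A q -> b <= q x) -> b <= m x.
  by move=> bq; apply: lb_le_inf => [|_ [q Aq <-]]; [exists (q0 x), q0 | exact: bq].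
clearbody m; exists m => //; split=> [x y|t x t0].
- rewrite -lerBlDr; apply: (lem) => q Aq; rewrite lerBlDr -lerBlDl.
  apply: (lem) => r Ar; rewrite lerBlDl.
  wlog qr : q r x y Aq Ar / forall z, q z <= r z.
    move=> H; case: (Atot _ _ Aq Ar) => h; first exact: H.
    by rewrite addrC [_ + r y]addrC; exact: H.
  apply: le_trans (mle _ _ Aq) _; apply: le_trans ((Asub _ Aq).1.1 _ _) _.
  by rewrite lerD2l qr.
- rewrite -ler_pdivrMl //; apply: (lem) => q Aq; rewrite ler_pdivrMl //.
  by apply: le_trans (mle _ _ Aq) _; apply: (Asub _ Aq).1.2.
Qed.

(** The functional [m x = inf_(t >= 0) (q (x + t y) - t q y)] is what [q] and
    linearity along [y] force from above: a linear functional below [m] agrees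
    with [q] at [y].  It serves both to prescribe the value at a vector and to
    show that a minimal functional is odd. *)
Lemma sublinear_tilt q y : sublinear q ->
  exists m, [/\ sublinear m, forall x, m x <= q x & m (- y) <= - q y].
Proof.
move=> qs.
pose S x := [set q (x + t *: y) - t * q y | t in [set t | 0 <= t]]%classic.
pose m x := inf (S x).
have mle x t : 0 <= t -> m x <= q (x + t *: y) - t * q y.
  move=> t0; apply: ge_inf; last by exists t.
  exists (- q (- x)) => _ [s /= s0 <-].
  have: q (s *: y) <= q (x + s *: y) + q (- x).
    by apply: le_trans (qs.1 _ _); rewrite addrAC subrr add0r.
  have -> : q (s *: y) = s * q y.
    move: s0; rewrite le_eqVlt => /predU1P[<-|s0]; last exact: sublinearZ.
    by rewrite scale0r mul0r sublinear0.
  by move=> h; lra.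
have lem x b : (forall t, 0 <= t -> b <= q (x + t *: y) - t * q y) -> b <= m x.
  move=> bq; apply: lb_le_inf => [|_ [t t0 <-]]; last exact: bq.
  by exists (q (x + 0 *: y) - 0 * q y), 0 => /=.
clearbody m; exists m; split.
- split=> [x x'|s x s0].
  + rewrite -lerBlDr; apply: (lem) => t t0; rewrite lerBlDr -lerBlDl.
    apply: (lem) => t' t'0; rewrite lerBlDl.
    apply: le_trans (mle _ (t + t') _) _; first exact: addr_ge0.
    have := qs.1 (x + t *: y) (x' + t' *: y).
    by rewrite addrACA -scalerDl => h; lra.
  + rewrite -ler_pdivrMl //; apply: (lem) => t t0; rewrite ler_pdivrMl //.
    apply: le_trans (mle _ (s * t) _) _; first by rewrite mulr_ge0 // ltW.
    by rewrite -scalerA -scalerDr sublinearZ // mulrBr mulrA.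
- by move=> x; have := mle x 0 (lexx _); rewrite scale0r mul0r subr0 addr0.
- have := mle (- y) 1 ler01; rewrite scale1r addNr sublinear0 //.
  by rewrite mul1r sub0r.
Qed.

(** Tilting at [y] cannot lower a minimal [q], so [q (- y) <= - q y]: [q] is odd,
    and an odd sublinear functional is linear. *)
Lemma sublinear_minimal_linear q : sublinear q ->
  (forall m, sublinear m -> (forall x, m x <= q x) -> forall x, q x <= m x) ->
  scalar q.
Proof.
move=> qs qmin.
have qN y : q (- y) = - q y.
  have [m [ms mq my]] := sublinear_tilt y qs.
  apply/eqP; rewrite eq_le (le_trans (qmin m ms mq _) my) /=.
  by have := sublinearN_ge (- y) qs; rewrite opprK.
have qD x y : q (x + y) = q x + q y.
  apply/eqP; rewrite eq_le qs.1 /=.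
  by have := qs.1 (- x) (- y); rewrite -opprD !qN => h; lra.
have qZ t x : q (t *: x) = t * q x.
  have [t0|t0|->] := ltgtP t 0; last by rewrite scale0r mul0r sublinear0.
  - have := @sublinearZ q (- t) x qs; rewrite oppr_gt0 => /(_ t0).
    by rewrite scaleNr qN mulNr => /oppr_inj.
  - exact: sublinearZ.
by move=> t x y; rewrite qD qZ.
Qed.

(** Zorn's lemma is applied below the tilt of [p] at [v] instead of below [p],
    which forces the value at [v]. *)
Theorem hahn_banach_real p v : sublinear p ->
  exists f : {scalar V}, (forall x, f x <= p x) /\ f v = p v.
Proof.
move=> ps; have [p' [p's p'p p'v]] := sublinear_tilt v ps.
pose T := {q : V -> R | sublinear q /\ forall x, q x <= p' x}.
pose le (q r : T) := `[< forall x, sval r x <= sval q x >].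
have [|||A Atot|[q [qs qp]] qmin] := @Zorn T le.
- by move=> q; apply/asboolP.
- move=> q r s /asboolP qr /asboolP rs; apply/asboolP => x.
  exact: le_trans (rs x) (qr x).
- move=> [q hq] [r hr] /asboolP /= qr /asboolP /= rq.
  apply: eq_exist => /=; apply/funext => x.
  by apply/eqP; rewrite eq_le qr rq.
- have [[q0 Aq0]|A0] := pselect (exists s, A s); last first.
    exists (exist _ p' (conj p's (fun x => lexx _))) => q Aq.
    by case: A0; exists q.
  have [|q [s _ <-]|q r [s As <-] [t At <-]|m ms mle] :=
      @sublinear_inf_chain p' [set sval s | s in A]%classic.
  + by exists (sval q0), q0.
  + exact: (svalP s).
  + by have [/asboolP h|/asboolP h] := Atot s t As At; [right|left].
  + have mp x : m x <= p' x.
      by apply: le_trans (mle (sval q0) x _) ((svalP q0).2 x); exists q0.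
    exists (exist _ m (conj ms mp)) => q Aq; apply/asboolP => x /=.
    by apply: mle; exists q.
have qlin : scalar q.
  apply: sublinear_minimal_linear => // m ms mq x.
  have mp z : m z <= p' z := le_trans (mq z) (qp z).
  have qm : le (exist _ q (conj qs qp)) (exist _ m (conj ms mp)) by exact/asboolP.
  by have [->] := qmin _ qm.
pose f : {scalar V} := HB.pack q (GRing.isLinear.Build _ _ _ _ q qlin).
exists f; split=> [x|] /=; first exact: le_trans (qp x) (p'p x).
apply/eqP; rewrite eq_le (le_trans (qp v) (p'p v)) /=.
have := le_trans (qp (- v)) p'v.
by rewrite -[q (- v)]/(f (- v)) linearN lerN2.
Qed.

End RealHahnBanach.

(** * Seminorms over the complex numbers *)

Section ComplexSeminorms.
Variable R : realType.

Lemma normr_rnorm (V : normedZmodType R[i]) (x : V) : `|x| = (rnorm x)%:C.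
Proof.
by rewrite /rnorm; have /ger0_Im : 0 <= `|x| by []; case: `|x| => a b /= ->.
Qed.

Lemma rnorm_ge0 (V : normedZmodType R[i]) (x : V) : 0 <= rnorm x.
Proof. by rewrite -lecR -normr_rnorm rmorph0 normr_ge0. Qed.

Lemma rnorm0_eq0 (V : normedZmodType R[i]) (x : V) : rnorm x = 0 -> x = 0.
Proof. by move=> x0; apply: normr0_eq0; rewrite normr_rnorm x0. Qed.

Lemma rnormD (V : normedZmodType R[i]) (x y : V) :
  rnorm (x + y) <= rnorm x + rnorm y.
Proof.
by rewrite -lecR rmorphD /= -!normr_rnorm ler_normD.
Qed.

Lemma rnormZ (V : normedModType R[i]) (c : R[i]) (x : V) :
  rnorm (c *: x) = rnorm c * rnorm x.
Proof.
by apply: (@complexI R); rewrite rmorphM /= -!normr_rnorm normrZ.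
Qed.

Lemma rnormM (c d : R[i]) : rnorm (c * d) = rnorm c * rnorm d.
Proof.
by apply: (@complexI R); rewrite rmorphM /= -!normr_rnorm normrM.
Qed.

Lemma rnorm_real (t : R) : rnorm t%:C = `|t|.
Proof.
apply: (@complexI R).
by rewrite -normr_rnorm normc_def /= expr0n addr0 sqrtr_sqr.
Qed.

Lemma Re_le_rnorm (c : R[i]) : complex.Re c <= rnorm c.
Proof.
apply: le_trans (ler_norm _) _.
by rewrite -lecR -normr_rnorm normc_ge_Re.
Qed.

Lemma rnorm_rotation (c : R[i]) :
  exists2 e : R[i], rnorm e = 1 & e * c = (rnorm c)%:C.
Proof.
have [->|c0] := eqVneq c 0.
  exists 1; first by rewrite (rnorm_real 1) normr1.
  by rewrite mulr0 (rnorm_real 0) normr0.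
have c0' : rnorm c != 0 by apply: contra c0 => /eqP/rnorm0_eq0 ->.
exists ((rnorm c)%:C / c); last by rewrite divfK.
apply: (mulIf c0'); rewrite -rnormM divfK // mul1r rnorm_real ger0_norm //.
exact: rnorm_ge0.
Qed.

Lemma seminorm_rnorm (V : normedModType R[i]) : is_seminorm (@rnorm R V).
Proof. by split; [exact: rnorm_ge0|exact: rnormD|exact: rnormZ]. Qed.

Section Seminorm.
Variables (V : lmodType R[i]) (p : V -> R).
Hypothesis ps : is_seminorm p.

Lemma seminorm_ge0 x : 0 <= p x. Proof. by case: ps. Qed.

Lemma seminormD x y : p (x + y) <= p x + p y. Proof. by case: ps. Qed.

Lemma seminormZ c x : p (c *: x) = rnorm c * p x. Proof. by case: ps. Qed.

Lemma seminormZ_real (t : R) x : 0 <= t -> p (t%:C *: x) = t * p x.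
Proof. by move=> t0; rewrite seminormZ rnorm_real ger0_norm. Qed.

Lemma seminorm0 : p 0 = 0.
Proof. by rewrite -(scale0r 0) (seminormZ_real 0) // mul0r. Qed.

End Seminorm.

(** A separate name for the carrier keeps the real scaling apart from the
    complex one in the inference of module structures. *)
Definition realified (V : lmodType R[i]) : Type := V.

HB.instance Definition _ (V : lmodType R[i]) :=
  GRing.Zmodule.on (realified V).

Section Realified.
Variable V : lmodType R[i].

Definition real_scale (t : R) (x : realified V) : realified V := t%:C *: (x : V).

Let real_scaleA s t x : real_scale s (real_scale t x) = real_scale (s * t) x.
Proof. by rewrite /real_scale scalerA rmorphM. Qed.

Let real_scale1 : left_id 1 real_scale.
Proof. by move=> x; rewrite /real_scale scale1r. Qed.

Let real_scaleDr : right_distributive real_scale +%R.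
Proof. by move=> t x y; rewrite /real_scale -scalerDr. Qed.

Let real_scaleDl x : {morph real_scale^~ x : s t / s + t}.
Proof. by move=> s t; rewrite /real_scale rmorphD scalerDl. Qed.

HB.instance Definition _ := GRing.Zmodule_isLmodule.Build R (realified V)
  real_scaleA real_scale1 real_scaleDr real_scaleDl.

End Realified.

(** A real functional [f] is the real part of [x |-> f x - i f (i x)], and a
    rotation of the argument turns the bound on the real part into a bound on the
    modulus. *)
Theorem hahn_banach (V : lmodType R[i]) (p : V -> R) (v : V) : is_seminorm p ->
  exists g : {scalar V}, (forall x, rnorm (g x) <= p x) /\ rnorm (g v) = p v.
Proof.
move=> ps.
have [|f [fp fv]] := @hahn_banach_real R (realified V) p v.
  split=> [|t x t0]; first exact: seminormD.
  by rewrite [p _](seminormZ_real ps) // ltW.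
pose g (x : V) : R[i] := Complex (f x) (- f ('i *: x)).
have fZ (t : R) (x : V) : f (t%:C *: x) = t * f x := scalarZ f t x.
have fD (x y : V) : f (x + y) = f x + f y := linearD f x y.
have fN (x : V) : f (- x) = - f x := linearN f x.
have fZC a b x : f ((a +i* b)%C *: x) = a * f x + b * f ('i *: x).
  have -> : (a +i* b)%C = a%:C + b%:C * 'i by simpc.
  by rewrite scalerDl -scalerA fD !fZ.
have fii x : f ('i *: ('i *: x)) = - f x.
  by rewrite scalerA -expr2 sqr_i scaleN1r fN.
have glin : scalar g.
  move=> [a b] x y; rewrite /g scalerDr scalerA mulrC -scalerA !fD !(fZC a b) fii.
  by simpc.
pose G : {scalar V} := HB.pack g (GRing.isLinear.Build _ _ _ _ g glin).
have Gp x : rnorm (G x) <= p x.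
  have [e e1 eG] := rnorm_rotation (G x).
  rewrite -[p x]mul1r -e1 -(seminormZ ps); apply: le_trans (fp (e *: x)).
  have : G (e *: x) = e * G x by rewrite linearZ.
  by rewrite eG => /(congr1 (@complex.Re R)) /= <-.
exists G; split=> //; apply/eqP; rewrite eq_le Gp /= -fv.
exact: (Re_le_rnorm (G v)).
Qed.

(** * Operator norms *)

Section OperatorNorms.
Variables (V W X : lmodType R[i]) (p : V -> R) (q : W -> R) (r : X -> R).
Hypotheses (ps : is_seminorm p) (qs : is_seminorm q) (rs : is_seminorm r).

Let normalize_le1 (U : lmodType R[i]) (s : U -> R) u : is_seminorm s ->
  s u != 0 -> s ((s u)^-1%:C *: u) = 1.
Proof.
by move=> ss su; rewrite seminormZ_real ?invr_ge0 ?seminorm_ge0 // mulVf.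
Qed.

Lemma op_norm_ge0 (T : V -> W) : op_bounded p q T -> 0 <= op_norm p q T.
Proof.
move=> [M TM]; apply: le_trans (seminorm_ge0 qs (T 0)) _.
apply: ub_le_sup; last by exists 0 => //=; rewrite seminorm0.
exists `|M| => _ [u /= u1 <-]; apply: le_trans (TM u) _.
apply: le_trans (ler_norm _) _; rewrite normrM ler_piMr //.
by rewrite ger0_norm // seminorm_ge0.
Qed.

(** Boundedness is what handles the vectors of seminorm zero, which cannot be
    normalized. *)
Lemma op_norm_bound (T : V -> W) u : scalable T -> op_bounded p q T ->
  q (T u) <= op_norm p q T * p u.
Proof.
move=> TZ Tb; have [M TM] := Tb.
have [pu0|pu0] := eqVneq (p u) 0.
  by rewrite (le_trans (TM u)) // pu0 !mulr0.
have pu : 0 < p u by rewrite lt_def pu0 seminorm_ge0.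
rewrite -ler_pdivrMr // mulrC -(seminormZ_real qs) ?invr_ge0 ?seminorm_ge0 // -TZ.
apply: ub_le_sup; last by exists ((p u)^-1%:C *: u) => //=; rewrite normalize_le1.
exists `|M| => _ [w /= w1 <-]; apply: le_trans (TM w) _.
apply: le_trans (ler_norm _) _; rewrite normrM ler_piMr //.
by rewrite ger0_norm // seminorm_ge0.
Qed.

Lemma op_norm_le (T : V -> W) M : 0 <= M ->
  (forall u, q (T u) <= M * p u) -> op_norm p q T <= M.
Proof.
move=> M0 TM; apply: ge_sup.
  by exists (q (T 0)), 0 => //=; rewrite seminorm0.
by move=> _ [u /= u1 <-]; apply: le_trans (TM u) _; rewrite ler_piMr.
Qed.

Lemma biop_norm_ge (B : V -> W -> X) u v : biop_bounded p q r B ->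
  p u <= 1 -> q v <= 1 -> r (B u v) <= biop_norm p q r B.
Proof.
move=> [M BM] u1 v1; apply: ub_le_sup; last by exists (u, v).
exists `|M| => _ [[w z] /= [w1 z1] <-]; apply: le_trans (BM w z) _.
apply: le_trans (ler_norm _) _; rewrite -mulrA normrM ler_piMr //.
rewrite ger0_norm ?mulr_ge0 ?seminorm_ge0 //.
by rewrite mulr_ile1 ?seminorm_ge0.
Qed.

Lemma biop_norm_ge0 (B : V -> W -> X) : biop_bounded p q r B ->
  0 <= biop_norm p q r B.
Proof.
move=> Bb; apply: le_trans (seminorm_ge0 rs (B 0 0)) _.
by apply: biop_norm_ge; rewrite // seminorm0.
Qed.

Lemma biop_norm_bound (B : V -> W -> X) u v :
  (forall v, scalable (B^~ v)) -> (forall u, scalable (B u)) ->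
  biop_bounded p q r B -> r (B u v) <= biop_norm p q r B * p u * q v.
Proof.
move=> BZl BZr Bb; have [M BM] := Bb.
have [pu0|pu0] := eqVneq (p u) 0.
  by rewrite (le_trans (BM u v)) // pu0 !(mulr0, mul0r).
have [qv0|qv0] := eqVneq (q v) 0.
  by rewrite (le_trans (BM u v)) // qv0 !mulr0.
have pu : 0 < p u by rewrite lt_def pu0 seminorm_ge0.
have qv : 0 < q v by rewrite lt_def qv0 seminorm_ge0.
rewrite -ler_pdivrMr // -ler_pdivrMr // mulrC [_ / q v]mulrC.
rewrite -!(seminormZ_real rs) ?invr_ge0 ?seminorm_ge0 // -BZr -BZl.
by apply: biop_norm_ge; rewrite // normalize_le1.
Qed.

Lemma biop_norm_le (B : V -> W -> X) M : 0 <= M ->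
  (forall u v, p u <= 1 -> q v <= 1 -> r (B u v) <= M) ->
  biop_norm p q r B <= M.
Proof.
move=> M0 BM; apply: ge_sup.
  by exists (r (B 0 0)), (0, 0) => //=; rewrite !seminorm0.
by move=> _ [[u v] /= [u1 v1] <-]; exact: BM.
Qed.

End OperatorNorms.

End ComplexSeminorms.

(** * Linear maps on tensor products *)

Section TensorMaps.
Variable K : comNzRingType.
Implicit Types E F G : lmodType K.

Definition tensor_lift E F G (f : {bilinear E -> F -> G}) :
    {linear tensor E F -> G} :=
  HB.pack (tlift f) (GRing.isLinear.Build _ _ _ _ (tlift f) (tlift_is_linear f)).

Lemma tensor_liftE E F G (f : {bilinear E -> F -> G}) x y :
  tensor_lift f (tens x y) = f x y.
Proof. exact: tlift_tens. Qed.

Lemma tensor_ind E F (P : tensor E F -> Prop) :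
  P 0 -> (forall u v, P u -> P v -> P (u + v)) ->
  (forall x y, P (tens x y)) -> forall u, P u.
Proof.
by move=> P0 PD Pt u; rewrite (tensor_sum u); elim/big_ind: _.
Qed.

Lemma tensor_ext E F G (f g : {linear tensor E F -> G}) :
  (forall x y, f (tens x y) = g (tens x y)) -> f =1 g.
Proof.
by move=> fg; elim/tensor_ind => [|u v fu fv|//]; rewrite ?linear0 // !linearD fu fv.
Qed.

Section Contractions.
Variables E F : lmodType K.

Definition scale_right (h : F -> K) (x : E) (y : F) : E := h y *: x.

Lemma scale_right_bilinear (h : {scalar F}) :
  bilinear_for *:%R *:%R (scale_right h).
Proof.
split=> [y|x] a u v; rewrite /scale_right /=.
  by rewrite scalerDr !scalerA mulrC.
by rewrite linearP scalerDl scalerA.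
Qed.

HB.instance Definition _ (h : {scalar F}) :=
  bilinear_isBilinear.Build _ _ _ _ _ _ (scale_right h) (scale_right_bilinear h).

Definition scale_left (g : E -> K) (x : E) (y : F) : F := g x *: y.

Lemma scale_left_bilinear (g : {scalar E}) :
  bilinear_for *:%R *:%R (scale_left g).
Proof.
split=> [y|x] a u v; rewrite /scale_left /=.
  by rewrite linearP scalerDl scalerA.
by rewrite scalerDr !scalerA mulrC.
Qed.

HB.instance Definition _ (g : {scalar E}) :=
  bilinear_isBilinear.Build _ _ _ _ _ _ (scale_left g) (scale_left_bilinear g).

(** These are [id ⊗ h] and [g ⊗ id], with the scalar factor absorbed. *)
Definition contract_right (h : {scalar F}) : {linear tensor E F -> E} :=
  tensor_lift (scale_right h).

Definition contract_left (g : {scalar E}) : {linear tensor E F -> F} :=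
  tensor_lift (scale_left g).

Lemma contract_right_tens (h : {scalar F}) x y :
  contract_right h (tens x y) = h y *: x.
Proof. exact: tensor_liftE. Qed.

Lemma contract_left_tens (g : {scalar E}) x y :
  contract_left g (tens x y) = g x *: y.
Proof. exact: tensor_liftE. Qed.

Lemma contract_swap (g : {scalar E}) (h : {scalar F}) u :
  g (contract_right h u) = h (contract_left g u).
Proof.
elim/tensor_ind: u => [|u v gu gv|x y]; first by rewrite !linear0.
  by rewrite !linearD gu gv.
by rewrite contract_right_tens contract_left_tens !linearZ /= mulrC.
Qed.

End Contractions.

End TensorMaps.

Arguments contract_right {K E F} h : simpl never.
Arguments contract_left {K E F} g : simpl never.

(** If the first term [x ⊗ y] of a representation of [w] has [h y != 0], then
    [(id ⊗ h) w = 0] expresses [x] through the other left factors, which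
    gives a representation with one term less. *)
Theorem tensor_separated (K : fieldType) (E F : lmodType K)
    (H : {scalar F} -> Prop) (w : tensor E F) :
  (forall y, (forall h, H h -> h y = 0) -> y = 0) ->
  (forall h, H h -> contract_right h w = 0) -> w = 0.
Proof.
move=> Hsep.
have -> : w = \sum_(p <- repr w) tens p.1 p.2 by exact: tensor_sum.
elim: {w}(size _) {-2}(repr w) (erefl (size (repr w))) => [|n IHn] s.
  by move=> /size0nil -> _; rewrite big_nil.
case: s => // -[x y] s [sn]; rewrite big_cons => w0.
have [Hy|] := pselect (forall h, H h -> h y = 0).
  move: w0; rewrite (Hsep y Hy) linear0r add0r; exact: IHn.
move=> /existsNP[h /not_implyP[Hh /eqP hy]].
have xE : x = - (h y)^-1 *: \sum_(p <- s) h p.2 *: p.1.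
  have := w0 h Hh; rewrite linearD contract_right_tens linear_sum.
  under eq_bigr do rewrite contract_right_tens.
  move=> /eqP; rewrite addrC addr_eq0 => /eqP ->.
  by rewrite scalerN scaleNr opprK scalerA mulVf // scale1r.
pose t := [seq (p.1, p.2 - (h p.2 / h y) *: y) | p <- s].
suff wt : tens x y + \sum_(p <- s) tens p.1 p.2 = \sum_(p <- t) tens p.1 p.2.
  by rewrite wt; apply: IHn => [|k Hk]; rewrite ?size_map // -wt w0.
rewrite big_map /= {1}xE linearZl_LR linear_sumlz /= scaler_sumr -big_split /=.
apply: eq_bigr => p _; rewrite linearBr linearZl_LR linearZr_LR scalerA.
by rewrite addrC mulNr scaleNr mulrC.
Qed.

(** * Amplifications *)

Section Amplifications.
Variables (R : realType) (L : normedModType R[i]).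
Implicit Types (a b : {linear L -> L}) (E F G : lmodType R[i]).

HB.instance Definition _ E a :=
  GRing.isLinear.Build _ _ _ _ (@Lact R L E a) (Lact_linear a).

HB.instance Definition _ E F (phi : {linear E -> F}) :=
  GRing.isLinear.Build _ _ _ _ (@amplification R L E F phi)
    (@amplification_linear R L E F phi).

HB.instance Definition _ (dia : {bilinear L -> L -> L}) E F G
    (B : {bilinear E -> F -> G}) :=
  bilinear_isBilinear.Build _ _ _ _ _ _ (@biamplification R L dia E F G B)
    (biamplification_bilinear dia B).

HB.instance Definition _ (dia : {bilinear L -> L -> L}) E F :=
  bilinear_isBilinear.Build _ _ _ _ _ _ (@Ldiamond R L dia E F)
    (@Ldiamond_bilinear R L dia E F).

Lemma LactD E a (u v : tensor L E) : Lact a (u + v) = Lact a u + Lact a v.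
Proof. exact: linearD. Qed.

Lemma Lact_id E a (u : tensor L E) : a =1 id -> Lact a u = u.
Proof.
move=> a1.
elim/tensor_ind: u => [|u v uu vv|xi x]; first by rewrite linear0.
  by rewrite linearD /= uu vv.
by rewrite Lact_tens a1.
Qed.

Lemma Lact_comp E a b (c : {linear L -> L}) (u : tensor L E) : c =1 a \o b ->
  Lact a (Lact b u) = Lact c u.
Proof.
move=> cab.
elim/tensor_ind: u => [|u v uu vv|xi x]; first by rewrite !linear0.
  by rewrite !linearD /= uu vv.
by rewrite !Lact_tens cab.
Qed.

Lemma amplification_Lact E F (phi : {linear E -> F}) a (u : tensor L E) :
  amplification phi (Lact a u) = Lact a (amplification phi u).
Proof.
elim/tensor_ind: u => [|u v uu vv|xi x]; first by rewrite !linear0.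
  by rewrite !linearD /= uu vv.
by rewrite Lact_tens !amplification_tens Lact_tens.
Qed.

Lemma contract_right_Lact E (f : {scalar E}) a (u : tensor L E) :
  contract_right f (Lact a u) = a (contract_right f u).
Proof.
elim/tensor_ind: u => [|u v uu vv|xi x]; first by rewrite !linear0.
  by rewrite LactD !linearD uu vv.
by rewrite Lact_tens !contract_right_tens linearZ.
Qed.

Section Diamond.
Variables (dia : {bilinear L -> L -> L}) (E F : lmodType R[i]).

Lemma amplification_Ldiamond G (B : {bilinear E -> F -> G})
    (T : {linear tensor E F -> G}) :
  (forall x y, T (tens x y) = B x y) -> forall u v,
  amplification T (Ldiamond dia u v) = biamplification dia B u v.
Proof.
move=> TB; elim/tensor_ind => [|u u' IHu IHu'|xi x] v.
- by rewrite !linear0l linear0.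
- by rewrite !linearDl linearD /= IHu IHu'.
elim/tensor_ind: v => [|v v' IHv IHv'|eta y].
- by rewrite !linear0r linear0.
- by rewrite !linearDr linearD /= IHv IHv'.
by rewrite Ldiamond_tens biamplification_tens amplification_tens TB.
Qed.

Lemma contract_right_Ldiamond (f : {scalar E}) (h : {scalar F}) u v :
  contract_right (f \o contract_right h) (Ldiamond dia u v) =
  dia (contract_right f u) (contract_right h v).
Proof.
elim/tensor_ind: u => [|u u' IHu IHu'|xi x].
- by rewrite linear0l !linear0 linear0l.
- by rewrite linearDl !linearD IHu IHu' linearDl.
elim/tensor_ind: v => [|v v' IHv IHv'|eta y].
- by rewrite linear0r !linear0.
- by rewrite linearDr !linearD IHv IHv'.
rewrite Ldiamond_tens !contract_right_tens.
rewrite [X in X *: _ = _](_ : _ = f (h y *: x)).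
  by rewrite linearZ /= linearZl_LR linearZr_LR scalerA mulrC.
by rewrite -contract_right_tens.
Qed.

End Diamond.

(** * Bounded operators on the coefficient space *)

Lemma bounded_op_le a M : 0 <= M -> (forall x, rnorm (a x) <= M * rnorm x) ->
  bounded_op a /\ bop_norm a <= M.
Proof.
move=> M0 aM; split; first by exists M.
by apply: op_norm_le => //; exact: seminorm_rnorm.
Qed.

Lemma bop_norm_ge0 a : bounded_op a -> 0 <= bop_norm a.
Proof. by apply: op_norm_ge0; exact: seminorm_rnorm. Qed.

Lemma bop_norm_bound a x : bounded_op a -> rnorm (a x) <= bop_norm a * rnorm x.
Proof.
move=> ab; apply: op_norm_bound => //; try exact: seminorm_rnorm.
by move=> c y; rewrite linearZ.
Qed.

Lemma bounded_op_id : bounded_op (idfun : {linear L -> L}) /\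
  bop_norm (idfun : {linear L -> L}) <= 1.
Proof. by apply: bounded_op_le => // x; rewrite mul1r. Qed.

Lemma bounded_op_comp a b : bounded_op a -> bounded_op b ->
  bounded_op (a \o b) /\ bop_norm (a \o b) <= bop_norm a * bop_norm b.
Proof.
move=> ab bb; apply: bounded_op_le => [|x].
  by rewrite mulr_ge0 // bop_norm_ge0.
apply: le_trans (bop_norm_bound _ ab) _; rewrite -mulrA.
by rewrite ler_wpM2l ?bop_norm_ge0 // bop_norm_bound.
Qed.

Definition rank_one_fun (g : L -> R[i]) (xi : L) (x : L) : L := g x *: xi.

Lemma rank_one_linear (g : {scalar L}) xi : linear (rank_one_fun g xi).
Proof.
by move=> c x y; rewrite /rank_one_fun linearP scalerDl scalerA.
Qed.

Definition rank_one (g : {scalar L}) (xi : L) : {linear L -> L} :=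
  HB.pack (rank_one_fun g xi)
    (GRing.isLinear.Build _ _ _ _ (rank_one_fun g xi) (rank_one_linear g xi)).

Lemma rank_one_bounded (g : {scalar L}) xi (M : R) : 0 <= M ->
  (forall x, rnorm (g x) <= M * rnorm x) ->
  bounded_op (rank_one g xi) /\ bop_norm (rank_one g xi) <= M * rnorm xi.
Proof.
move=> M0 gM; apply: bounded_op_le => [|x].
  by rewrite mulr_ge0 // rnorm_ge0.
by rewrite [rank_one g xi x]/(g x *: xi) rnormZ mulrAC ler_wpM2r // rnorm_ge0.
Qed.

Lemma Lact_rank_one E (g : {scalar L}) xi (u : tensor L E) :
  Lact (rank_one g xi) u = tens xi (contract_left g u).
Proof.
elim/tensor_ind: u => [|u v uu vv|eta x].
- by rewrite !linear0 linear0r.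
- by rewrite !linearD /= uu vv linearDr.
by rewrite Lact_tens contract_left_tens linearZr_LR /= linearZl_LR.
Qed.

Lemma norming_functional (xi : L) : xi != 0 ->
  exists g : {scalar L}, (forall x, rnorm (g x) <= rnorm x) /\ g xi != 0.
Proof.
move=> xi0; have [g [gle gxi]] := hahn_banach xi (seminorm_rnorm L).
exists g; split=> //; apply: contra xi0 => /eqP gxi0; apply/eqP/rnorm0_eq0.
by rewrite -gxi gxi0 (rnorm_real 0) normr0.
Qed.

Lemma bounded_op_transitive (zeta xi : L) : zeta != 0 ->
  exists2 a : {linear L -> L}, bounded_op a & a zeta = xi.
Proof.
move=> z0; have [g [gle gz0]] := norming_functional z0.
exists (rank_one g ((g zeta)^-1 *: xi)).
  by apply: (rank_one_bounded _ (M := 1) _ _).1 => // x; rewrite mul1r.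
transitivity (g zeta *: ((g zeta)^-1 *: xi)); first by [].
by rewrite scalerA divff // scale1r.
Qed.

Section SeparatingFunctionals.
Variables (E : lmodType R[i]) (nE : tensor L E -> R) (xi0 : L).
Hypotheses (nEs : is_Lseminorm nE) (xi0_neq0 : xi0 != 0).

Lemma tens_eq0 (x : E) : tens xi0 x = 0 -> x = 0.
Proof.
move=> xx0; have [g [_ gz0]] := norming_functional xi0_neq0.
apply: (scalerI gz0); rewrite scaler0 -contract_left_tens xx0.
exact: linear0.
Qed.

(** The map [x |-> nE (xi0 x)] is the norm that an L-norm induces on [E] itself,
    up to the factor [|xi0|]. *)
Definition contractive_functional (f : {scalar E}) : Prop :=
  forall x, rnorm (f x) <= nE (tens xi0 x).

(** Such a functional is automatically bounded after amplification.  If [g] is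
    a norming functional of [id ⊗ f] at [u], then
    [(g ⊗ f) u = f ((g ⊗ id) u)], and [xi0 ((g ⊗ id) u)] is
    the image of [u] under an operator of rank one and norm at most the norm of
    [xi0]. *)
Lemma contract_right_bound (f : {scalar E}) u : contractive_functional f ->
  rnorm (contract_right f u) <= rnorm xi0 * nE u.
Proof.
move=> fc; have [g [gle <-]] := hahn_banach (contract_right f u) (seminorm_rnorm L).
have [|x|gb gn] := @rank_one_bounded g xi0 1 => //.
  by rewrite mul1r.
rewrite contract_swap; apply: le_trans (fc _) _; rewrite -Lact_rank_one.
apply: le_trans (nEs.2 _ gb _) _.
by rewrite ler_wpM2r ?(seminorm_ge0 nEs.1) // (le_trans gn) // mul1r.
Qed.

Lemma contractive_functional_separates :
  (forall u, nE u = 0 -> u = 0) -> forall x,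
  (forall f, contractive_functional f -> f x = 0) -> x = 0.
Proof.
move=> nE0 x fx0.
have nx : is_seminorm (fun x => nE (tens xi0 x)).
  case: nEs => ns _; split=> [y|y z|c y]; first exact: (seminorm_ge0 ns).
    by rewrite linearDr; exact: (seminormD ns).
  by rewrite linearZr_LR; exact: (seminormZ ns).
have [f [fle fx]] := hahn_banach x nx.
by apply: tens_eq0; apply: nE0; rewrite -fx fx0 // (rnorm_real 0) normr0.
Qed.

End SeparatingFunctionals.

End Amplifications.

(** * The tensor product seminorm *)

Section TensorNorm.
Variables (R : realType) (L : normedModType R[i]).
Variables (dia : {bilinear L -> L -> L}) (E F : lmodType R[i]).
Variables (nE : tensor L E -> R) (nF : tensor L F -> R).
Hypotheses (nE_semi : is_Lseminorm nE) (nF_semi : is_Lseminorm nF).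
Hypotheses (L_neq0 : exists xi : L, xi <> 0) (dia_metric : metric_diamond dia).

Let nE_ge0 u : 0 <= nE u. Proof. exact: (seminorm_ge0 nE_semi.1). Qed.
Let nF_ge0 v : 0 <= nF v. Proof. exact: (seminorm_ge0 nF_semi.1). Qed.

Local Notation N := (Ltensor_norm dia nE nF).
Implicit Types (U V : tensor L (tensor E F)) (a b : {linear L -> L}).

Definition representation_costs U : set R :=
  [set s | exists (n : nat) (a : 'I_n -> {linear L -> L})
                  (u : 'I_n -> tensor L E) (v : 'I_n -> tensor L F),
    [/\ forall k, bounded_op (a k),
        U = \sum_(k < n) Lact (a k) (Ldiamond dia (u k) (v k)) &
        s = \sum_(k < n) bop_norm (a k) * nE (u k) * nF (v k)]]%classic.

Lemma representation_costs0 : representation_costs 0 0.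
Proof.
exists 0%N, (fun=> idfun), (fun=> 0), (fun=> 0).
by split; [case|rewrite big_ord0|rewrite big_ord0].
Qed.

Lemma representation_costs_diamond a u v : bounded_op a ->
  representation_costs (Lact a (Ldiamond dia u v)) (bop_norm a * nE u * nF v).
Proof.
move=> ab; exists 1%N, (fun=> a), (fun=> u), (fun=> v).
by split=> [//||]; rewrite big_ord1.
Qed.

Lemma representation_costsD U V s t :
  representation_costs U s -> representation_costs V t ->
  representation_costs (U + V) (s + t).
Proof.
move=> [m [a [u [v [ab -> ->]]]]] [n [a' [u' [v' [a'b -> ->]]]]].
pose glue (T : Type) (f : 'I_m -> T) (g : 'I_n -> T) (k : 'I_(m + n)) :=
  match fintype.split k with inl i => f i | inr j => g j end.
have gluel T f g i : @glue T f g (lshift n i) = f i.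
  by rewrite /glue (unsplitK (inl i)).
have gluer T f g j : @glue T f g (rshift m j) = g j.
  by rewrite /glue (unsplitK (inr j)).
exists (m + n)%N, (glue _ a a'), (glue _ u u'), (glue _ v v'); split.
- by move=> k; rewrite /glue; case: (fintype.split k).
- rewrite big_split_ord.
  by congr (_ + _); apply: eq_bigr => i _; rewrite ?gluel ?gluer.
- rewrite big_split_ord.
  by congr (_ + _); apply: eq_bigr => i _; rewrite ?gluel ?gluer.
Qed.

Lemma representation_costs_ge0 U s : representation_costs U s -> 0 <= s.
Proof.
move=> [n [a [u [v [ab _ ->]]]]]; apply: sumr_ge0 => k _.
by rewrite !mulr_ge0 ?bop_norm_ge0.
Qed.

(** With [zeta := xi0 ⋄ xi0], which is nonzero since [⋄] is metric, a bounded
    operator [a] with [a zeta = xi] gives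
    [xi (x ⊗ y) = a . (xi0 x ⋄ xi0 y)]. *)
Lemma representation_costs_nonempty U : (representation_costs U !=set0)%classic.
Proof.
have [xi0 /eqP xi00] := L_neq0.
have z0 : dia xi0 xi0 != 0.
  by rewrite -normr_eq0 dia_metric mulf_neq0 // normr_eq0.
elim/tensor_ind: U => [|U V [s Us] [t Vt]|xi w].
- by exists 0; exact: representation_costs0.
- by exists (s + t); exact: representation_costsD.
elim/tensor_ind: w => [|w w' [s ws] [t wt]|x y].
- by exists 0; rewrite linear0r; exact: representation_costs0.
- by exists (s + t); rewrite linearDr; exact: representation_costsD.
have [a ab az] := bounded_op_transitive xi z0.
exists (bop_norm a * nE (tens xi0 x) * nF (tens xi0 y)).
have -> : tens xi (tens x y) = Lact a (Ldiamond dia (tens xi0 x) (tens xi0 y)).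
  by rewrite Ldiamond_tens Lact_tens az.
exact: representation_costs_diamond.
Qed.

Lemma Ltensor_norm_le U s : representation_costs U s -> N U <= s.
Proof.
by move=> Us; apply: ge_inf => //; exists 0 => t; exact: representation_costs_ge0.
Qed.

Lemma le_Ltensor_norm U m :
  (forall s, representation_costs U s -> m <= s) -> m <= N U.
Proof. exact: lb_le_inf (representation_costs_nonempty U). Qed.

Lemma Ltensor_norm_ge0 U : 0 <= N U.
Proof. by apply: le_Ltensor_norm => s; exact: representation_costs_ge0. Qed.

Lemma Ltensor_norm0 : N 0 = 0.
Proof.
apply/eqP; rewrite eq_le Ltensor_norm_ge0 Ltensor_norm_le //.
exact: representation_costs0.
Qed.

Lemma Ltensor_normD U V : N (U + V) <= N U + N V.
Proof.
rewrite -lerBlDr; apply: le_Ltensor_norm => s Us; rewrite lerBlDr -lerBlDl.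
apply: le_Ltensor_norm => t Vt; rewrite lerBlDl.
exact/Ltensor_norm_le/representation_costsD.
Qed.

Lemma Ltensor_norm_diamond a u v : bounded_op a ->
  N (Lact a (Ldiamond dia u v)) <= bop_norm a * nE u * nF v.
Proof. by move=> ab; exact/Ltensor_norm_le/representation_costs_diamond. Qed.

(** The maximality of [N]: subadditivity carries the bound from the elements
    [a . (u ⋄ v)] to the cost of any representation, and then to the infimum.
    Only subadditivity of [Q] is assumed, so that [Q] may be built from [N] before
    [N] is known to be a seminorm. *)
Lemma Ltensor_norm_largest (Q : tensor L (tensor E F) -> R) M U : 0 <= M ->
  Q 0 <= 0 -> (forall V W, Q (V + W) <= Q V + Q W) ->
  (forall a u v, bounded_op a ->
    Q (Lact a (Ldiamond dia u v)) <= M * (bop_norm a * nE u * nF v)) ->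
  Q U <= M * N U.
Proof.
move=> M0 Q0 QD Qdia.
have Qs s : representation_costs U s -> Q U <= M * s.
  move=> [n [a [u [v [ab -> ->]]]]]; rewrite mulr_sumr.
  elim/big_ind2: _ => [//|V s1 W s2 Vs Ws|k _]; last exact: Qdia.
  exact: le_trans (QD _ _) (lerD Vs Ws).
move: M0; rewrite le_eqVlt => /predU1P[M0|M0].
  have [s Us] := representation_costs_nonempty U.
  by have := Qs s Us; rewrite -M0 !mul0r.
rewrite -ler_pdivrMl //; apply: le_Ltensor_norm => s Us.
by rewrite ler_pdivrMl // Qs.
Qed.

Lemma Ltensor_normZ_le c U : N (c *: U) <= rnorm c * N U.
Proof.
apply: (@Ltensor_norm_largest (fun U => N (c *: U))).
- exact: rnorm_ge0.
- by rewrite scaler0 Ltensor_norm0.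
- by move=> V W; rewrite scalerDr Ltensor_normD.
- move=> a u v ab.
  have -> : c *: Lact a (Ldiamond dia u v) = Lact a (Ldiamond dia (c *: u) v).
    by rewrite linearZl_LR linearZ.
  apply: le_trans (Ltensor_norm_diamond _ _ ab) _.
  by rewrite (seminormZ nE_semi.1) le_eqVlt; apply/predU1P; left; ring.
Qed.

Lemma Ltensor_normZ c U : N (c *: U) = rnorm c * N U.
Proof.
have [->|c0] := eqVneq c 0.
  by rewrite scale0r Ltensor_norm0 (rnorm_real 0) normr0 mul0r.
apply/eqP; rewrite eq_le Ltensor_normZ_le /=.
have := Ltensor_normZ_le c^-1 (c *: U); rewrite scalerA mulVf // scale1r.
move=> /(ler_wpM2l (rnorm_ge0 c)); rewrite mulrA -rnormM divff //.
by rewrite (rnorm_real 1) normr1 mul1r.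
Qed.

Lemma Ltensor_norm_Lseminorm : is_Lseminorm N.
Proof.
split=> [|b bb U].
  split; [exact: Ltensor_norm_ge0|exact: Ltensor_normD|exact: Ltensor_normZ].
apply: (@Ltensor_norm_largest (fun U => N (Lact b U))).
- exact: bop_norm_ge0.
- by rewrite linear0 Ltensor_norm0.
- by move=> V W; rewrite LactD Ltensor_normD.
move=> a u v ab; have [bab ban] := bounded_op_comp bb ab.
rewrite (@Lact_comp _ _ _ b a (b \o a)) //.
apply: le_trans (Ltensor_norm_diamond _ _ bab) _.
by rewrite -2!mulrA [leRHS]mulrA ler_wpM2r // mulr_ge0.
Qed.

Lemma rnorm_diamond xi eta : rnorm (dia xi eta) = rnorm xi * rnorm eta.
Proof.
by apply: (@complexI R); rewrite rmorphM /= -!normr_rnorm dia_metric.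
Qed.

(** Contracting [a . (u ⋄ v)] along [f ⊗ h] gives
    [a ((id ⊗ f) u ⋄ (id ⊗ h) v)]; the two contractions are bounded by
    [|xi0| |u|] and [|xi0| |v|], whence the constant. *)
Lemma contract_right_Ltensor_norm xi0 (f : {scalar E}) (h : {scalar F}) U :
  xi0 != 0 -> contractive_functional nE xi0 f -> contractive_functional nF xi0 h ->
  rnorm (contract_right (f \o contract_right h) U) <= rnorm xi0 ^+ 2 * N U.
Proof.
move=> xi00 fc hc.
apply: (@Ltensor_norm_largest
  (fun U => rnorm (contract_right (f \o contract_right h) U))).
- by rewrite sqr_ge0.
- by rewrite linear0 (seminorm0 (seminorm_rnorm L)).
- by move=> V W; rewrite linearD rnormD.
move=> a u v ab; rewrite contract_right_Lact contract_right_Ldiamond.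
apply: le_trans (bop_norm_bound _ ab) _; rewrite rnorm_diamond.
have -> : rnorm xi0 ^+ 2 * (bop_norm a * nE u * nF v) =
    bop_norm a * ((rnorm xi0 * nE u) * (rnorm xi0 * nF v)) by ring.
rewrite ler_wpM2l ?bop_norm_ge0 //.
by rewrite ler_pM ?rnorm_ge0 //; exact: contract_right_bound.
Qed.

(** Contraction along [f ⊗ h] is contraction along [h] followed by [f], so the
    functionals [f ⊗ h] separate [E ⊗ F] by one use of [tensor_separated]; the
    other use is for [L ⊗ (E ⊗ F)]. *)
Lemma Ltensor_norm_definite :
  (forall u, nE u = 0 -> u = 0) -> (forall v, nF v = 0 -> v = 0) ->
  forall U, N U = 0 -> U = 0.
Proof.
move=> nE0 nF0 U NU0; have [xi0 /eqP xi00] := L_neq0.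
pose H (k : {scalar tensor E F}) := exists f h,
  [/\ contractive_functional nE xi0 f, contractive_functional nF xi0 h &
      k = (f \o contract_right h)].
apply: (@tensor_separated _ _ _ H) => [t Ht|_ [f [h [fc hc ->]]]].
  apply: (@tensor_separated _ _ _ (contractive_functional nF xi0)) => [y|h hc].
    exact: contractive_functional_separates.
  apply: (contractive_functional_separates nE_semi xi00 nE0) => f fc.
  by apply: (Ht (f \o contract_right h)); exists f, h.
apply: rnorm0_eq0; apply/eqP; rewrite eq_le rnorm_ge0 andbT.
by apply: le_trans (contract_right_Ltensor_norm _ xi00 fc hc) _; rewrite NU0 mulr0.
Qed.

(** The representation [u ⋄ v = id . (u ⋄ v)] has cost at most [|u| |v|]. *)
Lemma Ldiamond_contractive u v : N (Ldiamond dia u v) <= nE u * nF v.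
Proof.
have [idb idn] := bounded_op_id L.
rewrite -[Ldiamond _ _ _](@Lact_id _ _ _ idfun) //.
apply: le_trans (Ltensor_norm_diamond _ _ idb) _; rewrite -mulrA ler_piMl //.
by rewrite mulr_ge0.
Qed.

Section UniversalProperty.
Variables (G : lmodType R[i]) (nG : tensor L G -> R).
Hypothesis nG_semi : is_Lseminorm nG.
Variable B : {bilinear E -> F -> G}.
Hypothesis B_bounded : Lbounded2 dia nE nF nG B.

Let Bnorm_ge0 : 0 <= Lb_norm2 dia nE nF nG B.
Proof. exact: (biop_norm_ge0 nE_semi.1 nF_semi.1 nG_semi.1). Qed.

Lemma amplification_lift_bound U :
  nG (amplification (tensor_lift B) U) <= Lb_norm2 dia nE nF nG B * N U.
Proof.
apply: (@Ltensor_norm_largest (fun U => nG (amplification (tensor_lift B) U))) => //.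
- by rewrite linear0 (seminorm0 nG_semi.1).
- by move=> V W; rewrite linearD (seminormD nG_semi.1).
move=> a u v ab; rewrite amplification_Lact.
rewrite (amplification_Ldiamond dia (tensor_liftE B)).
apply: le_trans (nG_semi.2 _ ab _) _.
rewrite -(mulrA (bop_norm a)) mulrCA ler_wpM2l ?bop_norm_ge0 // mulrA.
apply: (biop_norm_bound nE_semi.1 nF_semi.1 nG_semi.1) => //.
- by move=> w c z; rewrite linearZl_LR.
- by move=> w c z; rewrite linearZr_LR.
Qed.

Lemma Lbounded_lift : Lbounded N nG (tensor_lift B).
Proof. by exists (Lb_norm2 dia nE nF nG B); exact: amplification_lift_bound. Qed.

Lemma Lb_norm_lift : Lb_norm N nG (tensor_lift B) = Lb_norm2 dia nE nF nG B.
Proof.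
have Ns := Ltensor_norm_Lseminorm.1.
apply/eqP; rewrite eq_le; apply/andP; split.
  by apply: op_norm_le => // U; exact: amplification_lift_bound.
apply: (biop_norm_le nE_semi.1 nF_semi.1) => [|u v u1 v1].
  exact: (op_norm_ge0 Ns nG_semi.1 Lbounded_lift).
rewrite -(amplification_Ldiamond dia (tensor_liftE B)).
apply: le_trans (op_norm_bound Ns nG_semi.1 _ _ Lbounded_lift) _.
  by move=> c z; exact: linearZ_LR.
rewrite ler_piMr //; first exact: (op_norm_ge0 Ns nG_semi.1 Lbounded_lift).
apply: le_trans (Ldiamond_contractive _ _) _.
by rewrite mulr_ile1.
Qed.

End UniversalProperty.

End TensorNorm.

Theorem theorem4p6 (R : realType) (L : normedModType R[i])
    (L_neq0 : exists xi : L, xi <> 0)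
    (dia : {bilinear L -> L -> L}) (dia_metric : metric_diamond dia)
    (E F : lmodType R[i]) (nE : tensor L E -> R) (nF : tensor L F -> R)
    (nE_Lnorm : is_Lnorm nE) (nF_Lnorm : is_Lnorm nF) :
  is_Ltensor_product dia nE nF (Ltensor_norm dia nE nF)
    (tens : {bilinear E -> F -> tensor E F}).
Proof.
have [nEs nE0] := nE_Lnorm; have [nFs nF0] := nF_Lnorm; split.
- split; first exact: (Ltensor_norm_Lseminorm nEs nFs).
  exact: (Ltensor_norm_definite nEs nFs).
- exact: (Ldiamond_contractive dia nEs nFs).
move=> G nG [nGs _] B Bb; exists (tensor_lift B); split.
- exact: (Lbounded_lift nEs nFs).
- exact: tensor_liftE.
- by move=> T _ TB; apply: tensor_ext => x y; rewrite tensor_liftE TB.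
- exact: (Lb_norm_lift nEs nFs).
Qed.
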